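(* Let $q$ be a power of two, let $A$ be a $q$-modular witness in a graph $G$, and let $U\subseteq A$. For each $B\subseteq U$ let $n_B=|\{x\in A\setminus U:N(x)\cap U=B\}|$. Choose a lift $d$ modulo $2q$ of the common residue modulo $q$ of the degrees $\deg_A(v)$, $v\in A$, and define $b_A(v)\in\{0,1\}$ by $\deg_A(v)\equiv d+qb_A(v)\pmod{2q}$. Then: (1) There exists a family of pairwise disjoint $q$-element subsets of $A\setminus U$, each consisting of vertices with a common trace on $U$, such that, with $E$ their union and $W=A\setminus E$, the degrees $\deg_W(u)$, $u\in U$, are all congruent modulo $2q$, if and only if $[b_A|_U]\in\operatorname{Span}\{[\mathbf 1_B]: n_B\ge q\}$ in $\mathbb F_2^U/\langle\mathbf 1_U\rangle$. (2) If $n_B$ is divisible by $q$ for every $B\subseteq U$, then $U$ is $2q$-modular if and only if $[b_A|_U]=\sum_B\big(\tfrac{n_B}{q}\bmod 2\big)[\mathbf 1_B]$ in $\mathbb F_2^U/\langle\mathbf 1_U\rangle$.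
   Context: Graphs are finite simple; $\deg_S(v)$ is the degree of $v$ in the induced subgraph $G[S]$. A set $S$ is $q$-modular if $\deg_S(u)\equiv\deg_S(v)\pmod q$ for all $u,v\in S$. The trace of a vertex $x$ on $U$ is $N(x)\cap U$. $\mathbf 1_B$ is the indicator vector of $B$, $\mathbf 1_U$ the all-ones vector, and $\mathbb F_2^U/\langle\mathbf 1_U\rangle$ the quotient by constants; $b_A|_U$ is viewed as a vector in $\mathbb F_2^U$. *)

(* Defs.v *)
From HB Require Import structures.
From mathcomp Require Import all_boot all_order all_algebra.

Set Implicit Arguments.
Unset Strict Implicit.
Unset Printing Implicit Defensive.

Import GRing.Theory.
Local Open Scope ring_scope.
Local Open Scope quotient_scope.

(* The quotient vector space vT / W. The library quotient of a zmodType by a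
   subgroup carries no module structure; scaling descends to the classes, and
   a complement of W gives finite dimensionality. *)
Section VectorQuotient.

Variables (K : fieldType) (vT : vectType K) (W : {vspace vT}).

Definition quotv : Type := Quotient.quot W.

HB.instance Definition _ := GRing.Zmodule.on quotv.

Definition vclass (v : vT) : quotv := \pi_(Quotient.quot W) v.

Lemma vclass_eq u v : (vclass u == vclass v) = (u - v \in W).
Proof. by rewrite /vclass Quotient.idealrBE. Qed.

Lemma vclass_is_zmod_morphism : zmod_morphism vclass.
Proof. by move=> u v; rewrite /vclass raddfB. Qed.

HB.instance Definition _ :=
  GRing.isZmodMorphism.Build vT quotv vclass vclass_is_zmod_morphism.

Definition vrepr (x : quotv) : vT := repr (x : Quotient.quot W).

Lemma vreprK : cancel vrepr vclass.
Proof. by move=> x; rewrite /vclass /vrepr reprK. Qed.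

Definition quotv_scale (a : K) (x : quotv) : quotv := vclass (a *: vrepr x).

Lemma quotv_scaleE a v : quotv_scale a (vclass v) = vclass (a *: v).
Proof.
apply/eqP; rewrite vclass_eq -scalerBr rpredZ // -vclass_eq.
by rewrite vreprK.
Qed.

Lemma quotv_scaleA a b x :
  quotv_scale a (quotv_scale b x) = quotv_scale (a * b) x.
Proof. by rewrite -[x]vreprK !quotv_scaleE scalerA. Qed.

Lemma quotv_scale1 : left_id 1 quotv_scale.
Proof. by move=> x; rewrite -[x]vreprK quotv_scaleE scale1r. Qed.

Lemma quotv_scaleDr : right_distributive quotv_scale +%R.
Proof.
move=> a x y; rewrite -[x]vreprK -[y]vreprK -raddfD !quotv_scaleE.
by rewrite scalerDr raddfD.
Qed.

Lemma quotv_scaleDl x : {morph quotv_scale^~ x : a b / a + b}.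
Proof. by move=> a b; rewrite -[x]vreprK !quotv_scaleE scalerDl raddfD. Qed.

HB.instance Definition _ := GRing.Zmodule_isLmodule.Build K quotv
  quotv_scaleA quotv_scale1 quotv_scaleDr quotv_scaleDl.

Lemma vclass_is_scalable : scalable vclass.
Proof. by move=> a v; rewrite -quotv_scaleE. Qed.

HB.instance Definition _ :=
  GRing.isScalable.Build K vT quotv *:%R vclass vclass_is_scalable.

Lemma quotv_vect_iso : Vector.axiom (\dim W^C) quotv.
Proof.
have [f lin_f bij_f] := subvs_vect_iso W^C.
pose pr (v : vT) := daddv_pi W^C W v.
have dWC : (W^C :&: W = 0)%VS by rewrite capvC capv_compl.
have prW u v : u - v \in W -> pr u = pr v.
  move=> uvW; apply/eqP; rewrite -subr_eq0 -linearB /=.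
  have := daddv_pi_add dWC (memv_add (mem0v W^C) uvW).
  rewrite add0r => E; rewrite /pr.
  have dW : (W :&: W^C = 0)%VS by rewrite capv_compl.
  by rewrite -[X in _ == X](subrr (u - v)) -{3}(daddv_pi_id dW uvW) -{2}E addrK.
have prC v : v - pr v \in W.
  have /(daddv_pi_add dWC) {1}<- : v \in (W^C + W)%VS.
    by rewrite addvC addv_complf memvf.
  by rewrite /pr addrC addKr memv_pi.
exists (fun x => f (vsproj W^C (pr (vrepr x)))).
  move=> a x y; rewrite -lin_f -!linearP /=; congr (f (vsproj _ _)).
  by apply: prW; rewrite -vclass_eq vreprK linearP /= !vreprK.
case: bij_f => g fK gK; exists (fun r => vclass (vsval (g r))) => [x|r].
  rewrite fK vsprojK ?memv_pi // -[RHS]vreprK; apply/eqP.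
  by rewrite eq_sym vclass_eq prC.
rewrite (_ : pr _ = vsval (g r)) ?vsvalK ?gK //.
rewrite -[RHS](daddv_pi_id dWC (subvsP _)).
by apply: prW; rewrite -vclass_eq vreprK.
Qed.

HB.instance Definition _ := Lmodule_hasFinDim.Build K quotv quotv_vect_iso.

End VectorQuotient.

Local Open Scope nat_scope.

Section Graph.

Variables (T : finType) (e : rel T).

Definition trace (U : {set T}) (x : T) : {set T} := [set u in U | e x u].

Definition deg_in (S : {set T}) (v : T) : nat := #|[set w in S | e v w]|.

Definition modular_set (q : nat) (S : {set T}) : Prop :=
  {in S &, forall u v, deg_in S u = deg_in S v %[mod q]}.

Definition ntrace (A U B : {set T}) : nat :=
  #|[set x in A :\: U | trace U x == B]|.

End Graph.

Section Vectors.

Variables (T : finType) (U : {set T}).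

Definition F2vec := {ffun {x : T | x \in U} -> ('F_2)^o}.

Definition F2res (b : T -> bool) : F2vec := [ffun u => (b (val u))%:R%R].

Definition F2ind (B : {set T}) : F2vec := F2res (fun x => x \in B).

Definition F2ones : F2vec := [ffun=> 1%R].

Definition F2class (v : F2vec) : quotv <[F2ones]>%VS := vclass <[F2ones]>%VS v.

End Vectors.

(* Main.v *)
Require Import Defs.
From mathcomp Require Import all_boot all_order all_algebra.
Import GRing.Theory.

(** Deleting from [A] a set [E] that meets the neighbourhood of every [u] in
    [U] in [q * c u] vertices changes [deg_A(u) = d + q b(u)] to
    [d + q (b(u) + c(u))] modulo [2 q].  The remaining degrees are hence
    constant on [U] modulo [2 q] iff [b] and [c] agree on [U] in F_2 up to a
    constant.  For (1), [E] is a union of [q]-blocks with traces [B_i], so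
    [c = \sum_i 1_{B_i}], and over F_2 an element of a span is the sum of a
    subfamily, which a choice of one block per trace realizes.  For (2),
    [E = A \ U] and [c = \sum_B (n_B / q) 1_B]. *)

Set Implicit Arguments.
Unset Strict Implicit.
Unset Printing Implicit Defensive.

Local Open Scope nat_scope.

Section Degrees.

Variables (T : finType) (e : rel T).

Lemma deg_in_sum (S : {set T}) (v : T) : deg_in e S v = \sum_(w in S) e v w.
Proof.
rewrite /deg_in -sum1dep_card big_mkcondr /=.
by apply: eq_bigr => w _; case: (e v w).
Qed.

Lemma deg_in_setD (A E : {set T}) (v : T) :
  E \subset A -> deg_in e (A :\: E) v + deg_in e E v = deg_in e A v.
Proof.
move=> EA; rewrite !deg_in_sum (big_setID E (A := A)) /=.
by rewrite (setIidPr EA) addnC.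
Qed.

Lemma deg_in_cover (P : {set {set T}}) (v : T) :
  trivIset P -> deg_in e (cover P) v = \sum_(F in P) deg_in e F v.
Proof.
move=> tP; rewrite deg_in_sum big_trivIset //=.
by apply: eq_bigr => F _; rewrite deg_in_sum.
Qed.

(** All vertices of [F] see [u] alike: each is adjacent to [u] exactly when [u] lies in the common
    trace [B]. Symmetry of [e] passes from neighbours of [u] to traces of [x]. *)
Lemma deg_in_trace (U F B : {set T}) (u : T) :
    symmetric e -> u \in U -> {in F, forall x, trace e U x = B} ->
  deg_in e F u = #|F| * (u \in B).
Proof.
move=> e_sym uU trF; rewrite deg_in_sum -sum_nat_const.
apply: eq_bigr => x xF.
by rewrite -(trF x xF) inE uU e_sym.
Qed.

(** Partition [A :\: U] into the fibres of the trace map; [deg_in_trace] evaluates each one. *)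
Lemma deg_in_setD_trace (A U : {set T}) (u : T) :
    symmetric e -> u \in U ->
  deg_in e (A :\: U) u = \sum_(B in powerset U) ntrace e A U B * (u \in B).
Proof.
move=> e_sym uU; rewrite deg_in_sum.
rewrite (partition_big (trace e U) (mem (powerset U))) /=; last first.
  by move=> x _; rewrite powersetE; apply/subsetP=> y; rewrite inE => /andP[].
apply: eq_bigr => B _; rewrite /ntrace.
rewrite -(@deg_in_trace U _ B u e_sym uU) ?deg_in_sum.
  by apply: eq_bigl => x; rewrite inE.
by move=> x; rewrite inE => /andP[_ /eqP].
Qed.

End Degrees.

Section Classes.

Variables (T : finType) (U : {set T}).

Lemma natr_F2_odd (n : nat) : (n%:R = (odd n)%:R :> 'F_2)%R.
Proof. by rewrite -modn2 Fp_nat_mod. Qed.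

(** Subtraction in F_2 is xor, so the classes agree iff the pointwise xor is a multiple of the
    all-ones vector. *)
Lemma F2class_res_eqP (b c : T -> bool) :
  F2class (F2res U b) = F2class (F2res U c) <->
  {in U &, forall u v, b u (+) c u = b v (+) c v}.
Proof.
have F2xor (x y : bool) : (x%:R - y%:R = (x (+) y)%:R :> 'F_2)%R.
  by case: x y => [] []; apply/val_inj.
have F2bool : injective (fun x : bool => x%:R%R : 'F_2).
  by move=> [] [] //= /(congr1 val).
split.
  move/eqP; rewrite vclass_eq => /vlineP[k /ffunP bck].
  have bcE u : u \in U -> ((b u (+) c u)%:R = k :> 'F_2)%R.
    move=> uU; have := bck (Sub u uU); rewrite !ffunE /= F2xor => ->.
    exact: mulr1.
  by move=> u v uU vU; apply: F2bool; rewrite /= !bcE.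
move=> bc; apply/eqP; rewrite vclass_eq; apply/vlineP.
(* The constant is the xor at any point of [U]; if [U] is empty, any scalar serves. *)
case: (set_0Vmem U) => [U0|[v vU]].
  by exists 0%R; apply/ffunP=> -[u uU]; exfalso; rewrite U0 inE in uU.
exists (b v (+) c v)%:R%R; apply/ffunP=> -[u uU]; rewrite !ffunE /= F2xor.
by rewrite (bc u v) //; apply/esym/mulr1.
Qed.

Lemma F2class_res_sum (I : finType) (Q : {set I}) (m : I -> nat)
    (B : I -> {set T}) :
  F2class (F2res U (fun u => odd (\sum_(i in Q) m i * (u \in B i)))) =
  (\sum_(i in Q) (m i)%:R *: F2class (F2ind U (B i)))%R.
Proof.
rewrite /F2class; under [RHS]eq_bigr => i _ do rewrite -linearZ.
rewrite -linear_sum /=; congr (vclass _ _); apply/ffunP=> u; rewrite sum_ffunE !ffunE.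
rewrite -natr_F2_odd natr_sum; apply: eq_bigr => i _.
by rewrite !ffunE natrM.
Qed.

End Classes.

(** Every coefficient is 0 or 1, so it only decides whether an index joins [Q]. Choosing indices
    rather than vectors matters because distinct traces, such as [B] and its complement in [U], can
    have equal classes. *)
Lemma mem_span_F2 (vT : vectType 'F_2) (I : finType) (f : I -> vT)
    (s : seq I) (v : vT) :
    uniq s -> v \in <<[seq f i | i <- s]>>%VS ->
  exists2 Q : {set I}, {subset Q <= s} & v = (\sum_(i in Q) f i)%R.
Proof.
elim: s v => [|i s IHs] v /= => [_|/andP[is_ us]].
  rewrite span_nil memv0 => /eqP->; exists set0; last by rewrite big_set0.
  by move=> i; rewrite inE.
rewrite span_cons => /memv_addP[_ /vlineP[k ->] [w /(IHs _ us)[Q Qs ->] ->]].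
case/boolP: (k == 0%R) => [/eqP->|k0].
  by exists Q; rewrite ?scale0r ?add0r // => j /Qs; rewrite inE orbC => ->.
have -> : k = 1%R by case: k k0 => [[|[|[]]]] //= ? _; apply/val_inj.
have iQ : i \notin Q by apply: contra is_ => /Qs.
exists (i |: Q); last by rewrite big_setU1 //= scale1r.
by move=> j; rewrite !inE => /orP[->//|/Qs->]; rewrite orbT.
Qed.

Lemma modular_setD_F2class (T : finType) (e : rel T) (q d : nat)
    (A U E : {set T}) (b : T -> bool) (c : T -> nat) :
    0 < q -> U \subset A -> E \subset A ->
    {in A, forall v, deg_in e A v = d + q * b v %[mod 2 * q]} ->
    {in U, forall u, deg_in e E u = q * c u} ->
  {in U &, forall u v,
     deg_in e (A :\: E) u = deg_in e (A :\: E) v %[mod 2 * q]} <->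
  F2class (F2res U b) = F2class (F2res U (fun u => odd (c u))).
Proof.
move=> q0 UA EA bE cE; apply: iff_trans (iff_sym (F2class_res_eqP _ _ _)).
have degE u : u \in U ->
    deg_in e (A :\: E) u = d + q * (b u (+) odd (c u)) %[mod 2 * q].
  (* Adding the removed degree restores [deg_in e A u]; cancelling [d] and the factor [q] leaves an
     identity of parities. *)
  move=> uU; apply/eqP; rewrite -(eqn_modDr (q * c u)) -(cE u uU).
  rewrite deg_in_setD // cE // bE ?(subsetP UA) // -addnA eqn_modDl.
  rewrite -mulnDr -!(mulnC q) -!muln_modr eqn_pmul2l // !modn2.
  by rewrite oddD !oddb -addbA addbb addbF.
split=> [eqdeg u v uU vU|eqbc u v uU vU]; last by rewrite !degE // (eqbc u v).
have := eqdeg u v uU vU; rewrite !degE // => /eqP.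
rewrite eqn_modDl -!(mulnC q) -!muln_modr eqn_pmul2l // !modn2 !oddb.
by move/eqP; case: (_ (+) _); case: (_ (+) _).
Qed.

(** Take [q] elements from each fibre of the trace map. Fibres are disjoint, and since [q] is
    positive each block is nonempty and so determines its trace. *)
Lemma exists_trace_blocks (T : finType) (e : rel T) (q : nat)
    (A U : {set T}) (Q : {set {set T}}) :
    0 < q -> {in Q, forall B, q <= ntrace e A U B} ->
  exists F : {set T} -> {set T},
    [/\ {in Q, forall B, [/\ F B \subset A :\: U, #|F B| = q
                           & {in F B, forall x, trace e U x = B}]},
        {in Q &, injective F} & trivIset (F @: Q)].
Proof.
move=> q0 Qn.
pose fib B := [set x in A :\: U | trace e U x == B].
pose F B := [set x in take q (enum (fib B))].
have Ffib B x : x \in F B -> x \in A :\: U /\ trace e U x = B.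
  rewrite inE => /mem_take; rewrite mem_enum inE => /andP[-> /eqP //].
have FQ : {in Q, forall B, [/\ F B \subset A :\: U, #|F B| = q
                             & {in F B, forall x, trace e U x = B}]}.
  move=> B BQ; split; last by move=> x /Ffib[].
    by apply/subsetP=> x /Ffib[].
  rewrite cardsE (card_uniqP _) ?take_uniq ?enum_uniq // size_takel //.
  by rewrite -cardE; apply: Qn.
exists F; split=> //.
  move=> B C BQ CQ FBC; have [_ cB _] := FQ B BQ.
  have /card_gt0P[x xB] : 0 < #|F B| by rewrite cB.
  by have [_ <-] := Ffib _ _ xB; move: xB; rewrite FBC => /Ffib[].
apply/trivIsetP=> _ _ /imsetP[B BQ ->] /imsetP[C CQ ->] FBC.
rewrite disjoints_subset; apply/subsetP=> x /Ffib[_ tB]; rewrite inE.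
by apply: contra FBC => /Ffib[_ <-]; rewrite tB.
Qed.

Theorem mainTheorem5 (T : finType) (e : rel T)
    (e_sym : symmetric e) (e_irr : irreflexive e)
    (k q : nat) (q_pow2 : q = 2 ^ k)
    (A U : {set T}) (A_modular : modular_set e q A) (UA : U \subset A)
    (d : nat) (d_lift : {in A, forall v, deg_in e A v = d %[mod q]})
    (b : T -> bool)
    (bE : {in A, forall v, deg_in e A v = d + q * b v %[mod 2 * q]}) :
  ((exists P : {set {set T}},
      [/\ trivIset P,
          {in P, forall F : {set T},
             [/\ F \subset A :\: U, #|F| = q
               & {in F &, forall x y, trace e U x = trace e U y}]}
        & {in U &, forall u v,
             deg_in e (A :\: cover P) u
               = deg_in e (A :\: cover P) v %[mod 2 * q]}])
   <-> F2class (F2res U b)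
         \in <<[seq F2class (F2ind U B)
                 | B <- enum (powerset U) & (q <= ntrace e A U B)%N]>>%VS)
  /\
  ((forall B : {set T}, B \subset U -> q %| ntrace e A U B) ->
   (modular_set e (2 * q) U
    <-> F2class (F2res U b)
        = (\sum_(B in powerset U)
             ((ntrace e A U B %/ q) %% 2)%N%:R *: F2class (F2ind U B))%R)).
Proof.
have q0 : 0 < q by rewrite q_pow2 expn_gt0.
have coverA (P : {set {set T}}) :
    {in P, forall F : {set T}, F \subset A :\: U} -> cover P \subset A.
  by move=> PA; apply/bigcupsP=> F /PA /subset_trans; apply; apply: subsetDl.
split; first split.
- case=> P [tP PF eqdeg].
  (* The common trace of a block, read off any element; the default [set0] never occurs on [P],
     whose members have [q > 0] elements. *)
  pose B (F : {set T}) := if [pick x in F] is Some x then trace e U x else set0.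
  have trB F : F \in P -> {in F, forall x, trace e U x = B F}.
    move=> /PF[_ _ trF] x xF; rewrite /B; case: pickP => [y yF|/(_ x)].
      exact: trF.
    by rewrite /= xF.
  have PA : {in P, forall F : {set T}, F \subset A :\: U} by move=> F /PF[].
  pose c u := \sum_(F in P) 1 * (u \in B F).
  have cE : {in U, forall u, deg_in e (cover P) u = q * c u}.
    move=> u uU; rewrite deg_in_cover // big_distrr /=; apply: eq_bigr => F FP.
    have [_ <- _] := PF F FP.
    by rewrite mul1n (deg_in_trace e_sym uU (trB F FP)).
  move/(modular_setD_F2class q0 UA (coverA P PA) bE cE): eqdeg.
  rewrite F2class_res_sum => ->.
  apply: memv_suml => F FP.
  apply/memvZ/memv_span/map_f; have [FA Fq _] := PF F FP.
  (* The block lies in the fibre over [B F], which therefore has at least [q] elements. *)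
  have BE x : x \in F -> x \in A :\: U /\ trace e U x == B F.
    by move=> xF; rewrite (subsetP FA) // (trB F FP).
  rewrite mem_filter mem_enum powersetE -{1}Fq subset_leq_card /=; last first.
    by apply/subsetP=> x /BE[xA xB]; rewrite inE xA.
  have /card_gt0P[x /BE[_ /eqP<-]] : 0 < #|F| by rewrite Fq.
  by apply/subsetP=> y; rewrite inE => /andP[].
- case/mem_span_F2 => [|Q Qs bQ]; first by rewrite filter_uniq ?enum_uniq.
  have Qn : {in Q, forall B, q <= ntrace e A U B}.
    by move=> B /Qs; rewrite mem_filter => /andP[].
  have [F [FQ injF tF]] := exists_trace_blocks q0 Qn.
  exists (F @: Q); split=> //.
    move=> _ /imsetP[B /FQ[FA Fq FB] ->]; split=> // x y xF yF.
    by rewrite !FB.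
  apply/(modular_setD_F2class (c := fun u => \sum_(B in Q) 1 * (u \in B))
             q0 UA (coverA _ _) bE).
  + by move=> _ /imsetP[B /FQ[FA _ _] ->].
  (* Injectivity of [F] on [Q] turns the sum over blocks into one over traces. *)
  + move=> u uU; rewrite deg_in_cover // big_imset //= big_distrr /=.
    apply: eq_bigr => B /FQ[_ <- FB].
    by rewrite mul1n (deg_in_trace e_sym uU FB).
  rewrite bQ (F2class_res_sum _ _ (fun=> 1)).
  by apply: eq_bigr => B _; rewrite scale1r.
move=> q_dvd.
pose c u := \sum_(B in powerset U) (ntrace e A U B %/ q) * (u \in B).
have cE : {in U, forall u, deg_in e (A :\: U) u = q * c u}.
  move=> u uU; rewrite deg_in_setD_trace // big_distrr /=.
  apply: eq_bigr => B; rewrite powersetE => BU.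
  by rewrite mulnA (mulnC q) divnK ?q_dvd.
(* Casting to F_2 already reduces modulo 2. *)
under eq_bigr => B _ do rewrite Fp_nat_mod //.
rewrite -F2class_res_sum.
have := modular_setD_F2class q0 UA (subsetDl A U) bE cE.
(* Removing [A :\: U] from [A] leaves [U]. *)
by rewrite setDDr setDv set0U (setIidPr UA).
Qed.
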